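(* Let $\alpha, A, B$ be real constants with $\alpha\neq 0$, $B\ne 0$, and $A=\alpha$. Then every (well-defined) solution $(x_n)_{n=-3}^\infty$ of $$x_{n+1}=\frac{\alpha x_{n-3}}{A+B x_{n-1}x_{n-3}},\qquad n\ge 0,$$ with nonzero real initial data $x_{-3}=d$, $x_{-2}=c$, $x_{-1}=b$, $x_0=a$, converges to zero.
   Context: A solution is a real sequence $(x_n)_{n\ge -3}$ with the given initial data satisfying the recurrence for all $n\ge 0$; it is understood to be well defined, i.e. the denominator $A+Bx_{n-1}x_{n-3}$ is nonzero for every $n\ge 0$. *)

(* Defs.v *)
From Stdlib Require Import Reals ZArith.
From Coquelicot Require Import Coquelicot.

Open Scope R_scope.

(* The sequence (x_n)_{n >= -3} is the restriction to n >= -3 of a function on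
   Z; its values at n < -3 are unconstrained and never used. The nonvanishing
   clause is the well-definedness of the solution (needed since division by 0
   is total). *)
Definition is_solution (alpha A B d c b a : R) (x : Z -> R) : Prop :=
  (x (-3)%Z = d /\ x (-2)%Z = c /\ x (-1)%Z = b /\ x 0%Z = a) /\
  (forall n : Z, (0 <= n)%Z ->
     A + B * x (n - 1)%Z * x (n - 3)%Z <> 0 /\
     x (n + 1)%Z =
       alpha * x (n - 3)%Z / (A + B * x (n - 1)%Z * x (n - 3)%Z)).

(* Main.v *)
(** With [C = B / alpha], the reciprocals [w n = 1 / (C x(n) x(n+2))] satisfy
    [w (n+2) = w n + 1], so they grow linearly, and the recurrence becomes
    [x(n+4) = x(n) w n / (w n + 1)].  Since [(t / (t+1))^2 (t+2) <= t] for
    [t > 0], the quantity [x(n)^2 w n] eventually does not increase when [n]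
    grows by 4; hence it is bounded above and [x(n)^2 = O(1/n)]. *)
Require Import Defs.
From Stdlib Require Import Reals ZArith Lra Lia.
From Coquelicot Require Import Coquelicot.

Open Scope R_scope.

(** Each residue class modulo 4 is bounded by its first term from [N] on, so the largest of four
    consecutive values serves as [M]. *)
Lemma bounded_above_of_decr_step4 (Q : nat -> R) (N : nat) :
  (forall n, (N <= n)%nat -> Q (n + 4)%nat <= Q n) ->
  exists M, forall n, (N <= n)%nat -> Q n <= M.
Proof.
intros HQ.
exists (Rmax (Rmax (Q N) (Q (N + 1)%nat)) (Rmax (Q (N + 2)%nat) (Q (N + 3)%nat))).
set (M := Rmax _ _).
assert (H : forall k, Q (N + k)%nat <= M /\ Q (N + k + 1)%nat <= M /\
                      Q (N + k + 2)%nat <= M /\ Q (N + k + 3)%nat <= M).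
{ induction k as [|k [H0 [H1 [H2 H3]]]].
  - rewrite Nat.add_0_r; unfold M.
    repeat split; eauto using Rmax_l, Rmax_r, Rle_trans.
  - replace (N + S k)%nat with (N + k + 1)%nat by lia.
    replace (N + k + 1 + 1)%nat with (N + k + 2)%nat by lia.
    replace (N + k + 1 + 2)%nat with (N + k + 3)%nat by lia.
    replace (N + k + 1 + 3)%nat with (N + k + 4)%nat by lia.
    repeat split; try assumption.
    apply Rle_trans with (Q (N + k)%nat); [apply HQ; lia | assumption]. }
intros n Hn; replace n with (N + (n - N))%nat by lia; apply H.
Qed.

Lemma linear_growth_of_step2 (w : nat -> R) :
  (forall n, w (n + 2)%nat = w n + 1) ->
  exists m, forall n, m + INR n / 2 <= w n.
Proof.
(* The odd indices start at 1, where [INR n / 2] already contributes 1/2; hence the correction. *)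
intros Hw; exists (Rmin (w 0%nat) (w 1%nat - 1 / 2)).
set (m := Rmin _ _).
assert (H : forall n, m + INR n / 2 <= w n /\ m + INR (S n) / 2 <= w (S n)).
{ induction n as [|n [H0 H1]].
  - assert (H0 := Rmin_l (w 0%nat) (w 1%nat - 1 / 2)).
    assert (H1 := Rmin_r (w 0%nat) (w 1%nat - 1 / 2)).
    fold m in H0, H1; simpl; lra.
  - split; [assumption|].
    replace (S (S n)) with (n + 2)%nat by lia.
    rewrite Hw, plus_INR; simpl (INR 2); lra. }
intros n; apply H.
Qed.

Lemma is_lim_seq_0_of_sqr_linear (y : nat -> R) (m M : R) (N : nat) :
  (forall n, (N <= n)%nat -> y n ^ 2 * (m + INR n / 2) <= M) ->
  is_lim_seq y 0.
Proof.
intros H; apply is_lim_seq_spec; intros eps; simpl.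
(* From [K] on, [eps ^ 2 * (m + INR n / 2)] exceeds [Rabs M], so [Rabs (y n) >= eps] would violate
   the bound [M]. *)
destruct (INR_unbounded (2 * (Rabs M / eps ^ 2 + Rabs m))) as [K HK].
exists (max K N); intros n Hn; rewrite Rminus_0_r.
assert (He := cond_pos eps).
assert (He2 : 0 < eps ^ 2) by nra.
assert (HKn : INR K <= INR n) by (apply le_INR; lia).
assert (Hbound : y n ^ 2 * (m + INR n / 2) <= M) by (apply H; lia).
assert (Hm := Rle_abs (- m)); rewrite Rabs_Ropp in Hm.
assert (Ht : Rabs M / eps ^ 2 < m + INR n / 2) by lra.
assert (HM : Rabs M < eps ^ 2 * (m + INR n / 2)).
{ replace (Rabs M) with (eps ^ 2 * (Rabs M / eps ^ 2)) by (field; lra).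
  now apply Rmult_lt_compat_l. }
assert (HMle := Rle_abs M).
assert (HMpos := Rabs_pos M).
apply Rnot_le_lt; intros Hle.
assert (Hsq : eps ^ 2 <= y n ^ 2).
{ rewrite <- (pow2_abs (y n)).
  apply pow_incr; lra. }
nra.
Qed.

Section Recurrence.

Variables (C : R) (y : nat -> R).
Hypothesis C_neq0 : C <> 0.
Hypothesis y_init : y 0%nat <> 0 /\ y 1%nat <> 0 /\ y 2%nat <> 0 /\ y 3%nat <> 0.
Hypothesis y_den : forall n, 1 + C * y (n + 2)%nat * y n <> 0.
Hypothesis y_rec :
  forall n, y (n + 4)%nat = y n / (1 + C * y (n + 2)%nat * y n).

Lemma recurrence_neq0 n : y n <> 0.
Proof.
enough (H : y n <> 0 /\ y (n + 1)%nat <> 0 /\ y (n + 2)%nat <> 0 /\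
            y (n + 3)%nat <> 0) by apply H.
induction n as [|n [H0 [H1 [H2 H3]]]]; [exact y_init|].
replace (S n) with (n + 1)%nat by lia.
replace (n + 1 + 1)%nat with (n + 2)%nat by lia.
replace (n + 1 + 2)%nat with (n + 3)%nat by lia.
replace (n + 1 + 3)%nat with (n + 4)%nat by lia.
repeat split; try assumption.
rewrite y_rec; apply Rmult_integral_contrapositive_currified; [assumption|].
now apply Rinv_neq_0_compat.
Qed.

Let w n := / (C * y (n + 2)%nat * y n).

(** Multiplying the recurrence by [C * y (n + 2)] shows that the product p = [C * y (n + 2) * y n]
    is sent to p / (1 + p), whose reciprocal is 1 / p + 1. Nonvanishing of [y] makes these genuine
    reciprocals. *)
Lemma reciprocal_step2 n : w (n + 2)%nat = w n + 1.
Proof.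
unfold w; replace (n + 2 + 2)%nat with (n + 4)%nat by lia.
rewrite y_rec; assert (Hn := recurrence_neq0 n).
assert (Hn2 := recurrence_neq0 (n + 2)); assert (Hd := y_den n).
field; repeat split; auto.
Qed.

Lemma recurrence_reciprocal n : 0 < w n -> y (n + 4)%nat = y n * (w n / (w n + 1)).
Proof.
intros Hw; rewrite y_rec.
replace (C * y (n + 2)%nat * y n) with (/ w n) by (unfold w; apply Rinv_inv).
field; lra.
Qed.

Lemma recurrence_lim : is_lim_seq y 0.
Proof.
destruct (linear_growth_of_step2 w reciprocal_step2) as [m Hm].
(* Beyond -2m the lower bound [m + INR n / 2] is positive. *)
destruct (INR_unbounded (- 2 * m)) as [N HN].
assert (Hpos : forall n, (N <= n)%nat -> 0 < w n).
{ intros n Hn; apply le_INR in Hn; specialize (Hm n); lra. }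
destruct (bounded_above_of_decr_step4 (fun n => y n ^ 2 * w n) N) as [M HM].
{ intros n Hn; cbv beta; specialize (Hpos n Hn).
  rewrite recurrence_reciprocal by assumption.
  (* Two steps of size 2 give [w (n + 4) = w n + 2]; after cancelling [y n ^ 2], an inequality in t
     = [w n] alone remains. *)
  replace (n + 4)%nat with (n + 2 + 2)%nat by lia.
  rewrite !reciprocal_step2, Rpow_mult_distr, Rmult_assoc.
  apply Rmult_le_compat_l; [apply pow2_ge_0|].
  set (t := w n) in *.
  apply Rminus_le.
  replace ((t / (t + 1)) ^ 2 * (t + 1 + 1) - t) with (- (t / (t + 1) ^ 2))
    by (field; lra).
  assert (0 < t / (t + 1) ^ 2) by (apply Rdiv_lt_0_compat; nra).
  lra. }
apply (is_lim_seq_0_of_sqr_linear y m M N); intros n Hn.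
apply Rle_trans with (y n ^ 2 * w n); [|now apply HM].
apply Rmult_le_compat_l; [apply pow2_ge_0 | apply Hm].
Qed.

End Recurrence.

Theorem theorem3p2 (alpha A B : R) (halpha : alpha <> 0) (hB : B <> 0)
  (hA : A = alpha) (d c b a : R)
  (hd : d <> 0) (hc : c <> 0) (hb : b <> 0) (ha : a <> 0)
  (x : Z -> R) (hx : is_solution alpha A B d c b a x) :
  is_lim_seq (fun n : nat => x (Z.of_nat n)) 0.
Proof.
subst A; destruct hx as [[Hd [Hc [Hb Ha]]] Hrec].
(* Shifting by 3 puts the initial data at indices 0 to 3. Since A = [alpha], dividing numerator and
   denominator by [alpha] normalizes the recurrence, with [C = B / alpha]. *)
set (y := fun n : nat => x (Z.of_nat n - 3)%Z).
assert (Hy : forall n : nat,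
  1 + B / alpha * y (n + 2)%nat * y n <> 0 /\
  y (n + 4)%nat = y n / (1 + B / alpha * y (n + 2)%nat * y n)).
{ intros n; destruct (Hrec (Z.of_nat n)) as [Hden Hx]; [lia|].
  unfold y.
  replace (Z.of_nat (n + 2) - 3)%Z with (Z.of_nat n - 1)%Z by lia.
  replace (Z.of_nat (n + 4) - 3)%Z with (Z.of_nat n + 1)%Z by lia.
  set (p := x (Z.of_nat n - 1)%Z) in *; set (q := x (Z.of_nat n - 3)%Z) in *.
  assert (Hfac : 1 + B / alpha * p * q = (alpha + B * p * q) / alpha)
    by (field; assumption).
  rewrite Hfac, Hx; split.
  - apply Rmult_integral_contrapositive_currified; [assumption|].
    now apply Rinv_neq_0_compat.
  - field; auto. }
apply is_lim_seq_ext with (fun n : nat => y (n + 3)%nat).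
{ intros n; unfold y; f_equal; lia. }
apply (is_lim_seq_incr_n y 3).
apply (recurrence_lim (B / alpha)).
- apply Rmult_integral_contrapositive_currified; [assumption|].
  now apply Rinv_neq_0_compat.
- unfold y; simpl; rewrite Hd, Hc, Hb, Ha; auto.
- intros n; apply Hy.
- intros n; apply Hy.
Qed.
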